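(* Let $X$ be a semi-metrizable space satisfying (W3); that is, the topology of $X$ is $\mathcal T_d$ for some distance function $d$ on $X$ such that $B(x,\varepsilon)$ is a neighborhood of $x$ for every $x\in X$ and $\varepsilon>0$, and such that whenever $(x_n)_n$ is a sequence in $X$ and $x,y\in X$ satisfy $\lim_{n\to\infty}d(x_n,x)=\lim_{n\to\infty}d(x_n,y)=0$, then $x=y$. Then $X$ is weakly semi-metrizable.
   Context: All topological spaces are assumed $T_1$, and $\mathbb N=\{1,2,3,\dots\}$. A distance function on a nonempty set $X$ is a function $d:X\times X\to[0,\infty)$ with $d(x,y)=0\iff x=y$ and $d(x,y)=d(y,x)$ for all $x,y$ (no triangle inequality). Put $B(x,\varepsilon)=\{y\in X\mid d(x,y)<\varepsilon\}$. The topology $\mathcal T_d$ is defined by: $U\in\mathcal T_d$ iff for every $x\in U$ there is $\varepsilon>0$ with $B(x,\varepsilon)\subset U$. A family $\mathcal V=\{V_n^x\mid x\in X,n\in\mathbb N\}$ of subsets of $X$ is adapted to $d$ if $x\in\bigcap_{k=1}^nV_k^x\subset B(x,2^{-n})$ for all $x\in X$, $n\in\mathbb N$. In this case $\mathcal T_{d,\mathcal V}$ is the topology on $X$ in which $U$ is open iff for every $x\in U$ there is $n\in\mathbb N$ with $\bigcap_{k=1}^nV_k^x\subset U$; the triple $(X,d,\mathcal V)$, equipped with this topology, is called a weakly symmetric space. In a weakly symmetric space $(X,d,\mathcal V)$, a sequence $(x_n)_n$ is $\mathcal V$-converging to $x$, written $x_n\overset{\mathcal V}{\longrightarrow}x$,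 if for each $m\in\mathbb N$ the set $\{x_n\mid n\in\mathbb N\}\setminus\bigcap_{k=1}^mV_k^x$ is finite. A sequence is injective if its terms are pairwise distinct. For $A\subset X$, $C_{\mathcal V}(A)=A\cup\{x\in X\mid$ there is an injective sequence $(x_n)_n$ in $A$ with $x_n\overset{\mathcal V}{\longrightarrow}x\}$. A weakly symmetric space $(X,d,\mathcal V)$ is weakly semi-metric if $\overline A=C_{\mathcal V}(A)$ for every $A\subset X$ (closure in $\mathcal T_{d,\mathcal V}$) and the following holds: for every sequence $(x_n)_{n\in\mathbb N}$ in $X$ and every $x\in X$ with $x\in\bigcap_nV_n^{x_n}$, one has $\bigcap_nV_n^{x_n}=\{x\}$, and if moreover $x_n\in\bigcap_{k=1}^nV_k^{x_k}$ for every $n$, then $(x_n)_n$ converges to $x$. A topological space is weakly semi-metrizable if its topology equals $\mathcal T_{d,\mathcal V}$ for some weakly semi-metric space $(X,d,\mathcal V)$ (the distance function here may be any distance function on $X$). *)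

(* Defs.v *)
From HB Require Import structures.
From mathcomp Require Import all_boot all_order all_algebra.
From mathcomp Require Import all_classical all_reals all_analysis.
Set Implicit Arguments.
Unset Strict Implicit.
Unset Printing Implicit Defensive.
Import Order.TTheory GRing.Theory Num.Theory.
Import numFieldNormedType.Exports.
Local Open Scope classical_set_scope.
Local Open Scope ring_scope.

(* Indexing convention: the positive integers 1, 2, 3, ... are represented by
   nat, with k : nat standing for k.+1. Thus V x k stands for V_{k+1}^x, the
   intersection \bigcap_(k < n.+1) V x k for V_1^x `&` ... `&` V_{n+1}^x, and
   the corresponding radius is 2^-(n+1). *)

Definition distance_function (R : realType) (X : Type) (d : X -> X -> R) :=
  [/\ forall x y, 0 <= d x y,
      forall x y, d x y = 0 <-> x = y
    & forall x y, d x y = d y x].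

(* Not the ball of a pseudometric space: d need not satisfy the triangle
   inequality. *)
Definition dball (R : realType) (X : Type) (d : X -> X -> R) (x : X) (e : R) :
  set X := [set y | d x y < e].

(* X equipped with the topology T_d. *)
Definition distance_space (R : realType) (X : choiceType) (d : X -> X -> R) :
  Type := X.

Section DistanceTopology.
Context (R : realType) (X : choiceType) (d : X -> X -> R).

Definition distance_open (U : set X) :=
  forall x, U x -> exists2 e : R, 0 < e & dball d x e `<=` U.

Lemma distance_openT : distance_open setT.
Proof. by move=> x _; exists 1. Qed.

Lemma distance_openI : setI_closed distance_open.
Proof.
move=> A B oA oB x [Ax Bx].
have [e e0 eA] := oA _ Ax; have [f f0 fB] := oB _ Bx.
exists (Num.min e f); first by rewrite lt_min e0 f0.
by move=> y; rewrite /dball /= lt_min => /andP[ye yf]; split;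
  [exact: eA|exact: fB].
Qed.

Lemma distance_open_bigU (I : Type) (f : I -> set X) :
  (forall i, distance_open (f i)) -> distance_open (\bigcup_i f i).
Proof.
move=> of_ x [i _ fix_]; have [e e0 ef] := of_ i _ fix_.
by exists e => // y /ef fy; exists i.
Qed.

HB.instance Definition _ := Choice.on (distance_space d).
HB.instance Definition _ := isOpenTopological.Build (distance_space d)
  distance_openT distance_openI distance_open_bigU.

End DistanceTopology.

Definition semi_metric (R : realType) (X : choiceType) (d : X -> X -> R) :=
  distance_function d /\
  forall (x : distance_space d) (e : R), 0 < e -> nbhs x (dball d x e).

Definition W3 (R : realType) (X : Type) (d : X -> X -> R) :=
  forall (u : nat -> X) (x y : X),
    (fun n => d (u n) x) @ \oo --> (0 : R) ->
    (fun n => d (u n) y) @ \oo --> (0 : R) -> x = y.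

Definition adapted (R : realType) (X : Type) (d : X -> X -> R)
    (V : X -> nat -> set X) :=
  forall x n, (\bigcap_(k < n.+1) V x k) x /\
              \bigcap_(k < n.+1) V x k `<=` dball d x (2 ^- n.+1).

(* X equipped with the topology T_{d,V}, which depends on V only. *)
Definition weakly_symmetric_space (X : choiceType) (V : X -> nat -> set X) :
  Type := X.

Section WeaklySymmetricTopology.
Context (X : choiceType) (V : X -> nat -> set X).

Definition weakly_symmetric_open (U : set X) :=
  forall x, U x -> exists n : nat, \bigcap_(k < n.+1) V x k `<=` U.

Lemma weakly_symmetric_openT : weakly_symmetric_open setT.
Proof. by move=> x _; exists 0. Qed.

Lemma weakly_symmetric_openI : setI_closed weakly_symmetric_open.
Proof.
move=> A B oA oB x [Ax Bx].
have [m mA] := oA _ Ax; have [n nB] := oB _ Bx.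
exists (maxn m n) => y Vy; split.
- apply: mA => k /= km; apply: Vy => /=.
  by rewrite (leq_trans km) // ltnS leq_maxl.
- apply: nB => k /= kn; apply: Vy => /=.
  by rewrite (leq_trans kn) // ltnS leq_maxr.
Qed.

Lemma weakly_symmetric_open_bigU (I : Type) (f : I -> set X) :
  (forall i, weakly_symmetric_open (f i)) ->
  weakly_symmetric_open (\bigcup_i f i).
Proof.
move=> of_ x [i _ fix_]; have [n nf] := of_ i _ fix_.
by exists n => y /nf fy; exists i.
Qed.

HB.instance Definition _ := Choice.on (weakly_symmetric_space V).
HB.instance Definition _ := isOpenTopological.Build (weakly_symmetric_space V)
  weakly_symmetric_openT weakly_symmetric_openI weakly_symmetric_open_bigU.

End WeaklySymmetricTopology.

Definition V_converging (X : Type) (V : X -> nat -> set X)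
    (u : nat -> X) (x : X) :=
  forall m : nat, finite_set (range u `\` \bigcap_(k < m.+1) V x k).

Definition V_closure (X : Type) (V : X -> nat -> set X) (A : set X) : set X :=
  A `|` [set x | exists u : nat -> X,
    [/\ injective u, forall n, A (u n) & V_converging V u x]].

Definition weakly_semi_metric (R : realType) (X : choiceType)
    (d : X -> X -> R) (V : X -> nat -> set X) :=
  [/\ distance_function d,
      adapted d V,
      forall A : set (weakly_symmetric_space V), closure A = V_closure V A
    & forall (u : nat -> weakly_symmetric_space V)
             (x : weakly_symmetric_space V),
        (\bigcap_n V (u n) n) x ->
        \bigcap_n V (u n) n = [set x] /\
        ((forall n, (\bigcap_(k < n.+1) V (u k) k) (u n)) ->
         u @ \oo --> x)].

Definition weakly_semi_metrizable (R : realType) (X : topologicalType) :=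
  exists (d : X -> X -> R) (V : X -> nat -> set X),
    weakly_semi_metric d V /\
    forall U : set X, open U <-> @open (weakly_symmetric_space V) U.

(* Main.v *)
Require Import Defs.
From HB Require Import structures.
From mathcomp Require Import all_boot all_order all_algebra.
From mathcomp Require Import all_classical all_reals all_analysis.
Import Order.TTheory GRing.Theory Num.Theory.
Import numFieldNormedType.Exports.
Local Open Scope classical_set_scope.
Local Open Scope ring_scope.

(* Take for V_n^x the ball B(x, 2^-n). These balls are nested neighborhoods of
   x, so they generate T_d, and a point of the closure of A outside A is the
   limit of a sequence in A with strictly decreasing distances to x, which is
   therefore injective. If x lies in every B(x_n, 2^-n), then d(x_n, x) tends
   to 0: hence (x_n) converges to x, and such an x is unique by (W3). *)

Lemma open_distanceE {R : realType} {X : choiceType} (d : X -> X -> R)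
  (U : set X) : @open (distance_space d) U = distance_open d U.
Proof. by []. Qed.

Lemma open_weakly_symmetricE {X : choiceType} (V : X -> nat -> set X)
  (U : set X) : @open (weakly_symmetric_space V) U = weakly_symmetric_open V U.
Proof. by []. Qed.

Section DyadicBalls.
Context {R : realType} {X : choiceType} (d : X -> X -> R).

Definition dyadic_ball (x : X) (k : nat) : set X := dball d x (2 ^- k.+1).

Lemma subset_dyadic_ball (x : X) (m n : nat) : (m <= n)%N ->
  dyadic_ball x n `<=` dyadic_ball x m.
Proof.
move=> mn y /lt_le_trans; apply.
by rewrite lef_pV2 ?posrE ?exprn_gt0// ler_eXn2l ?ltr1n.
Qed.

Lemma bigcap_dyadic_ball (x : X) (n : nat) :
  \bigcap_(k < n.+1) dyadic_ball x k = dyadic_ball x n.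
Proof.
apply/seteqP; split => [y|y dxy k /= kn]; first by apply => /=.
exact: subset_dyadic_ball dxy.
Qed.

Lemma dball_dyadic (x : X) (e : R) : 0 < e ->
  exists n, dyadic_ball x n `<=` dball d x e.
Proof.
move=> e0; have [n _ nP] := near_infty_natSinv_expn_lt (PosNum e0).
exists n => y /lt_trans; apply.
by rewrite -div1r; apply: nP => /=.
Qed.

(** Dyadic radii are cofinal among the positive reals, so testing openness with them alone gives the
    same topology. *)
Lemma open_dyadic_ballE (U : set X) :
  @open (distance_space d) U <->
  @open (weakly_symmetric_space dyadic_ball) U.
Proof.
rewrite open_distanceE open_weakly_symmetricE; split=> oU x /oU.
  move=> [e /(dball_dyadic x)[n ne] eU]; exists n.
  by rewrite bigcap_dyadic_ball; apply: subset_trans eU.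
by move=> [n]; rewrite bigcap_dyadic_ball => nU; exists (2 ^- n.+1).
Qed.

Lemma nbhs_dyadic_ball_sub (x : weakly_symmetric_space dyadic_ball)
    (N : set X) : nbhs x N -> exists n, dyadic_ball x n `<=` N.
Proof.
rewrite nbhsE => -[U [oU Ux] UN]; move: oU.
rewrite open_weakly_symmetricE => /(_ x Ux)[n nU].
by exists n; rewrite -bigcap_dyadic_ball; apply: subset_trans UN.
Qed.

Lemma adapted_dyadic_ball : distance_function d -> adapted d dyadic_ball.
Proof.
move=> [_ d0 _] x n; rewrite bigcap_dyadic_ball; split => //.
by rewrite /dyadic_ball /dball/= (d0 x x).2// invr_gt0 exprn_gt0.
Qed.

Lemma dyadic_ball_cvg (u : nat -> weakly_symmetric_space dyadic_ball)
    (x : weakly_symmetric_space dyadic_ball) :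
  (fun n => d x (u n)) @ \oo --> (0 : R) -> u @ \oo --> x.
Proof.
move=> du N /nbhs_dyadic_ball_sub[m mN]; near=> n; apply: mN.
rewrite /dyadic_ball /dball/= (le_lt_trans (ler_norm _))//.
by near: n; apply: (cvgr0_norm_lt _ du); rewrite invr_gt0 exprn_gt0.
Unshelve. all: by end_near. Qed.

Lemma bigcap_dyadic_ball_dist_cvg0 (u : nat -> X) (x : X) :
  distance_function d -> (\bigcap_n dyadic_ball (u n) n) x ->
  (fun n => d (u n) x) @ \oo --> (0 : R).
Proof.
move=> [d_ge0 _ _] ux; apply/cvgr0Pnorm_lt => e e0.
have [n0 _ n0P] := near_infty_natSinv_expn_lt (PosNum e0).
exists n0 => // n /= n0n; rewrite ger0_norm//; apply: lt_trans (ux n I) _.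
by rewrite -div1r; apply: n0P => /=; rewrite (leq_trans n0n).
Qed.

Lemma V_closure_sub_closure
    (A : set (weakly_symmetric_space dyadic_ball)) :
  V_closure dyadic_ball A `<=` closure A.
Proof.
move=> x [Ax|[u [u_inj uA ux]]]; first exact: subset_closure.
move=> N /nbhs_dyadic_ball_sub[m mN].
(* If [N] missed [A], no term of [u] would lie in the ball inside [N]. The finite set given by
   V-convergence would then be all of [range u], which is infinite by injectivity. *)
apply: contrapT => AN0; have := ux m.
rewrite bigcap_dyadic_ball (_ : _ `\` _ = range u).
  move=> /(finite_preimage (in2W u_inj)); rewrite preimage_range.
  exact: infinite_nat.
apply: setDidl; apply: contrapT => /eqP/set0P[_ [[n _ <-] un]].
by apply: AN0; exists (u n); split; [exact: uA|exact: mN].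
Qed.

Context (d_sm : semi_metric d).

(** The neighborhood clause of [semi_metric], carried over through the equality of the two
    topologies. It yields points of [A] arbitrarily close to a point of [closure A]. *)
Lemma nbhs_dyadic_ball (x : weakly_symmetric_space dyadic_ball) (e : R) :
  0 < e -> nbhs x (dball d x e).
Proof.
move=> e0; have := d_sm.2 x e e0; rewrite !nbhsE => -[U [oU Ux] Ue].
by exists U => //; split => //; apply/open_dyadic_ballE.
Qed.

Lemma closure_sub_V_closure
    (A : set (weakly_symmetric_space dyadic_ball)) :
  closure A `<=` V_closure dyadic_ball A.
Proof.
move=> x Ax; have [|nAx] := pselect (A x); [by left|right].
have [[d_ge0 d0 _] _] := d_sm.
have dA y : A y -> 0 < d x y.
  move=> Ay; rewrite lt_neqAle d_ge0 andbT eq_sym.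
  by apply/eqP => /d0 xy; rewrite -xy in Ay.
(* One step of the recursion: the pair holds the index of the new term and the distance it has to
   beat. The guard [0 < nr.2] makes the choice total, with [x] as dummy value; by [dA] it holds at
   every distance that occurs. *)
have next (nr : nat * R) : exists y, 0 < nr.2 ->
    A y /\ d x y < Num.min nr.2 (2 ^- nr.1.+1).
  have [r0|_] := ltP 0 nr.2; last by exists x.
  have e0 : 0 < Num.min nr.2 (2 ^- nr.1.+1).
    by rewrite lt_min r0 invr_gt0 exprn_gt0.
  by have [y [Ay dy]] := Ax _ (nbhs_dyadic_ball x _ e0); exists y.
have {next} [f fP] := choice next.
(* The initial term has no predecessor to beat; any positive number would do for 1. *)
pose u := fix u n := if n is m.+1 then f (n, d x (u m)) else f (0, 1).
have uA n : A (u n).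
  elim: n => [|n IHn]; first by have [] := fP (0%N, 1) ltr01.
  by have [] := fP (n.+1, d x (u n)) (dA _ IHn).
have u_lt n : dyadic_ball x n (u n).
  case: n => [|n].
    by have [_] := fP (0%N, 1) ltr01; rewrite lt_min => /andP[].
  by have [_] := fP (n.+1, d x (u n)) (dA _ (uA n)); rewrite lt_min => /andP[].
have u_decr : {homo u : m n / (m < n)%N >-> d x n < d x m}.
  apply: homo_ltn => [y z t yz|n]; first by move=> /lt_trans; apply.
  by have [_] := fP (n.+1, d x (u n)) (dA _ (uA n)); rewrite lt_min => /andP[].
exists u; split => // [m n umn|m].
  by case: (ltngtP m n) => // /u_decr; rewrite umn ltxx.
(* By [u_lt] and nestedness, only terms of index below [m] can lie outside [dyadic_ball x m]. *)
apply: (@sub_finite_set _ _ (u @` `I_m)); last exact/finite_image/finite_II.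
rewrite bigcap_dyadic_ball => _ [[n _ <-] unm]; exists n => //=.
rewrite ltnNge; apply/negP => mn; apply: unm.
exact: subset_dyadic_ball (u_lt n).
Qed.

Lemma weakly_semi_metric_dyadic_ball :
  W3 d -> weakly_semi_metric d dyadic_ball.
Proof.
have d_dist := d_sm.1; have [_ _ dC] := d_dist.
move=> d_W3; split => //.
- exact: adapted_dyadic_ball.
- move=> A; apply/seteqP.
  by split; [exact: closure_sub_V_closure|exact: V_closure_sub_closure].
- move=> u x ux; have dux := bigcap_dyadic_ball_dist_cvg0 u x d_dist ux.
  split.
    apply/seteqP; split=> [y uy|_ ->//].
    by apply: (d_W3 u) => //; exact: bigcap_dyadic_ball_dist_cvg0.
  move=> _; apply: dyadic_ball_cvg.
  (* The hypothesis on [x] involves balls centred at the [u n], convergence involves balls centred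
     at [x]; symmetry of [d] joins the two. *)
  by under eq_fun do rewrite dC.
Qed.

End DyadicBalls.

Theorem theorem3p8 (R : realType) (X : topologicalType)
  (X_nonempty : [set: X] !=set0) (X_T1 : accessible_space X)
  (X_semi_metrizable_W3 : exists d : X -> X -> R,
     [/\ semi_metric d,
         forall U : set X, open U <-> @open (distance_space d) U
       & W3 d]) :
  weakly_semi_metrizable R X.
Proof.
have [d [d_sm openE d_W3]] := X_semi_metrizable_W3.
exists d, (dyadic_ball d); split; first exact: weakly_semi_metric_dyadic_ball.
by move=> U; rewrite openE; exact: open_dyadic_ballE.
Qed.
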